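(* Let $\alpha\ge 0$. Assume that $F:\mathbb{R}^d\to\mathbb{R}^p$ is continuous, that there exists $C_\alpha\ge0$ with $\sup_{x\in\mathbb{R}^d}\|F(x)\|(1+\|x\|^\alpha)^{-1}\le C_\alpha<+\infty$, and that there exists $\eta>0$ with $\int_{\mathbb{R}^d}\exp[\eta\|x\|^\alpha]\,\mathrm{d}\mu(x)<+\infty$. Then $L\in C^\infty(\mathrm{int}(\Theta_F))$ and for every $\theta\in\mathrm{int}(\Theta_F)$, $\nabla L(\theta)=-\pi_\theta(F)$. In addition, if there exists $\theta^\star\in\mathrm{int}(\Theta_F)$ such that $\nabla L(\theta^\star)=0$, then $\pi_{\theta^\star}$ is the solution of (P).
   Context: $\mu$ is a probability measure on $(\mathbb{R}^d,\mathcal{B}(\mathbb{R}^d))$ (the reference measure), and there is a point $x_0\in\mathbb{R}^d$ with $F(x_0)=0$ (standing assumption). For a probability measure $\pi$, $\pi(F)=\int F\,\mathrm{d}\pi$. $\mathcal{P}_\alpha$ is the set of Borel probability measures $\pi$ on $\mathbb{R}^d$ with $\int\|x\|^\alpha\,\mathrm{d}\pi(x)<+\infty$, and $\mathcal{P}_\alpha^F=\{\pi\in\mathcal{P}_\alpha:\pi(F)=0\}$. $\mathrm{KL}(\pi|\mu)=\int \frac{\mathrm{d}\pi}{\mathrm{d}\mu}\log\frac{\mathrm{d}\pi}{\mathrm{d}\mu}\,\mathrm{d}\mu$ if $\pi\ll\mu$ and $+\infty$ otherwise. Problem (P): minimize $\mathrm{KL}(\pi|\mu)$ subject to $\pi\in\mathcal{P}_\alpha^F$.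 $\Theta_F=\{\theta\in\mathbb{R}^p:\int\exp[-\langle\theta,F(x)\rangle]\,\mathrm{d}\mu(x)<+\infty\}$, with interior $\mathrm{int}(\Theta_F)$. For $\theta\in\Theta_F$, $L(\theta)=\log\int\exp[-\langle\theta,F(x)\rangle]\,\mathrm{d}\mu(x)$ and $\pi_\theta$ is the probability measure with $\frac{\mathrm{d}\pi_\theta}{\mathrm{d}\mu}(x)=\exp[-\langle\theta,F(x)\rangle-L(\theta)]$. *)

(* Defs.v *)
From HB Require Import structures.
From mathcomp Require Import all_boot all_order all_algebra.
From mathcomp Require Import all_classical all_reals all_analysis
  measurable_realfun.

Set Implicit Arguments.
Unset Strict Implicit.
Unset Printing Implicit Defensive.

Import Order.TTheory GRing.Theory Num.Theory.
Import numFieldNormedType.Exports.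

Local Open Scope classical_set_scope.
Local Open Scope ring_scope.

Section Euclidean.
Context (R : realType) (n : nat).
Implicit Types x y : 'rV[R]_n.

Definition dotp x y : R := \sum_(i < n) x 0 i * y 0 i.

(* The library norm `|x| on row vectors is the sup norm (same topology). *)
Definition enorm x : R := Num.sqrt (\sum_(i < n) x 0 i ^+ 2).

End Euclidean.

(* R^d with its Borel sigma-algebra *)
Notation borelRV R d := (g_sigma_algebraType (@open 'rV[R]_d)).

Section Differentiation.
Context (R : realType) (p : nat).
Implicit Types (f : 'rV[R]_p -> R) (U : set 'rV[R]_p).

Definition partial f (i : 'I_p) : 'rV[R]_p -> R :=
  fun x => 'D_(delta_mx 0 i) f x.

Definition grad f (x : 'rV[R]_p) : 'rV[R]_p := \row_i partial f i x.

(* Class C^k on an open set U. *)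
Fixpoint Ck (k : nat) U f : Prop :=
  match k with
  | 0 => {in U, continuous f}
  | k'.+1 => {in U, forall x, differentiable f x} /\
             forall i, Ck k' U (partial f i)
  end.

Definition Cinfty U f : Prop := forall k, Ck k U f.

End Differentiation.

Section KullbackLeibler.
Context d (T : measurableType d) (R : realType).
Implicit Types pi mu : probability T R.
Local Open Scope charge_scope.
Local Open Scope ereal_scope.

(* On pi << mu the Radon-Nikodym derivative takes finite values. *)
Definition KL pi mu : \bar R :=
  if `[< pi `<< mu >] then
    \int[mu]_x
      (let r := fine (('d (charge_of_finite_measure pi) '/d mu) x) in
       (r * ln r)%R)%:E
  else +oo.

End KullbackLeibler.

Section Constraints.
Context (R : realType) (d p : nat).
Implicit Types (F : 'rV[R]_d -> 'rV[R]_p) (pi mu : probability (borelRV R d) R).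
Local Open Scope ereal_scope.

(* The j-th coordinate of pi(F). For F continuous, this extended real is finite
   exactly when that coordinate of F is pi-integrable. *)
Definition mean pi F (j : 'I_p) : \bar R := \int[pi]_x (F x 0%R j)%:E.

Definition Palpha (alpha : R) : set (probability (borelRV R d) R) :=
  [set pi : probability (borelRV R d) R | \int[pi]_x (enorm x `^ alpha)%:E < +oo].

Definition PalphaF (alpha : R) F : set (probability (borelRV R d) R) :=
  [set pi | Palpha alpha pi /\ forall j, mean pi F j = 0].

Definition minimizer mu alpha F pi :=
  PalphaF alpha F pi /\
  forall pi', PalphaF alpha F pi' -> KL pi mu <= KL pi' mu.

(* Measures are functions on all subsets, hence uniqueness is up to equality on
   Borel sets. *)
Definition unique_minimizer mu alpha F pi :=
  minimizer mu alpha F pi /\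
  forall pi', minimizer mu alpha F pi' ->
    forall A, measurable A -> pi' A = pi A.

End Constraints.

Section Gibbs.
Context (R : realType) (d p : nat) (mu : probability (borelRV R d) R)
  (F : 'rV[R]_d -> 'rV[R]_p).
Local Open Scope ereal_scope.

Definition partition_function (theta : 'rV[R]_p) : \bar R :=
  \int[mu]_x (expR (- dotp theta (F x)))%:E.

Definition Theta : set 'rV[R]_p := [set theta | partition_function theta < +oo].

(* Only meaningful on Theta. *)
Definition logpartition (theta : 'rV[R]_p) : R := ln (fine (partition_function theta)).

(* The proofs cF and hth serve only to make gibbs cF hth a probability. *)
Definition gibbs (cF : continuous F) (theta : 'rV[R]_p) (hth : Theta theta)
    : set (borelRV R d) -> \bar R :=
  fun A => \int[mu]_(x in A)
    (expR (- dotp theta (F x) - logpartition theta))%:E.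

Let continuous_measurable (f : 'rV[R]_d -> R) :
  continuous f -> measurable_fun setT (f : borelRV R d -> R).
Proof.
move=> /continuousP cf; apply: (measurability _ (RGenOpens.measurableE R)).
move=> _ [_ [a [b ->] <-]]; rewrite setTI; apply: sub_sigma_algebra.
exact/cf/interval_open.
Qed.

Let measurable_dotp (cF : continuous F) theta :
  measurable_fun setT (fun x : borelRV R d => dotp theta (F x)).
Proof.
apply: measurable_sum => i; apply: measurable_funM => //.
apply: (continuous_measurable (f := fun x => F x 0%R i)) => x.
exact: (continuous_comp (cF x) (@coord_continuous _ _ _ _ _ _)).
Qed.

Let measurable_density (cF : continuous F) theta (c : R) : measurable_fun setT
  (fun x : borelRV R d => (expR (- dotp theta (F x) - c))%:E).
Proof.
apply/measurable_EFinP; apply: measurableT_comp => //.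
apply: measurable_funB => //; apply: measurableT_comp => //.
exact: measurable_dotp.
Qed.

Section instances.
Context (cF : continuous F) (theta : 'rV[R]_p) (hth : Theta theta).

Let gibbs0 : gibbs cF hth set0 = 0.
Proof. by rewrite /gibbs integral_set0. Qed.

Let gibbs_ge0 A : 0 <= gibbs cF hth A.
Proof. by apply: integral_ge0 => x _; rewrite lee_fin expR_ge0. Qed.

Let gibbs_sigma_additive : semi_sigma_additive (gibbs cF hth).
Proof.
apply: semi_sigma_additive_nng_induced; first exact: measurable_density.
by move=> x; rewrite lee_fin expR_ge0.
Qed.

HB.instance Definition _ := isMeasure.Build _ _ _ (gibbs cF hth)
  gibbs0 gibbs_ge0 gibbs_sigma_additive.

Let partition_gt0 : 0 < partition_function theta.
Proof.
rewrite lt_neqAle integral_ge0 ?andbT; last first.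
  by move=> x _; rewrite lee_fin expR_ge0.
apply/eqP => /esym Z0.
have mf : measurable_fun setT
    (fun x : borelRV R d => (expR (- dotp theta (F x)))%:E).
  by have := measurable_density cF theta 0%R; under eq_fun do rewrite subr0.
have /(ae_eq_integral_abs mu measurableT mf) f0 :
    \int[mu]_x `|(expR (- dotp theta (F x)))%:E| = 0.
  rewrite -[RHS]Z0; apply: eq_integral => x _.
  by rewrite gee0_abs// lee_fin expR_ge0.
have mu_gt0 : 0 < mu setT by rewrite probability_setT.
have := @filter_ex _ _ (ae_properfilter_algebraOfSetsType mu_gt0) _ f0.
by move=> [x /(_ I) [/eqP]]; rewrite gt_eqF// expR_gt0.
Qed.

Let gibbs_setT : gibbs cF hth setT = 1.
Proof.
have Zfin : partition_function theta \is a fin_num.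
  by rewrite ge0_fin_numE// ltW.
have Zpos : (0 < fine (partition_function theta))%R.
  by rewrite fine_gt0// partition_gt0.
rewrite /gibbs; under eq_integral do rewrite expRB mulrC EFinM.
rewrite ge0_integralZl//; last first.
  by have := measurable_density cF theta 0%R; under eq_fun do rewrite subr0.
rewrite -/(partition_function theta) /logpartition lnK ?posrE//.
by rewrite -{2}(fineK Zfin) -EFinM mulVf// gt_eqF.
Qed.

HB.instance Definition _ :=
  Measure_isProbability.Build _ _ _ (gibbs cF hth) gibbs_setT.

End instances.
End Gibbs.

(* Main.v *)
(* On the interior of the domain, [exp (- <theta, F>)] stays integrable after
   multiplication by [exp (delta |F|_1)] for some [delta > 0]. The second-order
   Taylor remainder of the exponential is therefore integrable, so each
   [theta |-> int F_i1 ... F_in exp (- <theta, F>) dmu] is Frechet differentiable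
   with partial derivatives of the same form. Smoothness of [L] follows since
   these functions, [1 / Z] and [ln Z] generate an algebra that is stable under
   partial derivatives.
   If [g] is the density of [pi_theta] and [r] that of a competitor [pi], the
   pointwise inequality [r ln r >= r ln g + r - g], strict unless [r = g],
   integrates to [KL(pi | mu) >= pi(ln g) = - L(theta)] because [pi(F) = 0]; when
   [grad L(theta) = 0] the measure [pi_theta] is admissible and attains this
   bound. *)
Require Import Defs.
From HB Require Import structures.
From mathcomp Require Import all_boot all_order all_algebra.
From mathcomp Require Import all_classical all_reals all_analysis
  measurable_realfun.
From mathcomp Require Import ring lra.
Import Order.TTheory GRing.Theory Num.Theory.
Import numFieldNormedType.Exports.
Local Open Scope classical_set_scope.
Local Open Scope ring_scope.

(** * Taylor remainder and growth bounds for the real exponential *)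

Section real_inequalities.
Context {R : realType}.
Implicit Types x y : R.

(** Convexity gives exp z - 1 <= z exp z, hence 0 <= exp y - 1 - y <= y (exp y - 1). For y >= 0 the
    same bound is applied once more to exp y - 1; for y < 0, exp y - 1 >= y gives at most y^2. *)
Lemma expR_remainder y : `|expR y - 1 - y| <= y ^+ 2 * expR `|y|.
Proof.
have E1 z : expR z - 1 <= z * expR z :> R.
  have := expR_ge1Dx (- z); rewrite -(ler_pM2r (expR_gt0 z)) -expRD addNr expR0.
  by rewrite mulrDl mul1r mulNr; lra.
have E0 := expR_ge1Dx y.
rewrite ger0_norm; last lra.
have [y0|y0] := leP 0 y.
  apply: le_trans (_ : y * (expR y - 1) <= _).
    by have := E1 y; lra.
  by rewrite ger0_norm// expr2 -mulrA ler_wpM2l.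
have le1 : 1 <= expR `|y| by rewrite -[leLHS]expR0 ler_expR.
have : y * (expR y - 1) <= y * y by rewrite ler_wnM2l//; lra.
have : y * y <= y ^+ 2 * expR `|y| by rewrite -expr2 ler_peMr// sqr_ge0.
by have := E1 y; lra.
Qed.

(** A single term of the exponential series, (delta y)^n / n! <= exp (delta y), dictates C = n! /
    delta^n. *)
Lemma exprn_le_expR n delta : 0 < delta ->
  exists2 C : R, 0 <= C & forall y, 0 <= y -> y ^+ n <= C * expR (delta * y).
Proof.
move=> delta0; exists (n`!%:R / delta ^+ n).
  by rewrite divr_ge0// exprn_ge0// ltW.
move=> y y0; rewrite mulrAC ler_pdivlMr ?exprn_gt0// -exprMn [y * _]mulrC.
have dy0 : 0 <= delta * y by rewrite mulr_ge0// ltW.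
rewrite -ler_pdivrMl ?ltr0n ?fact_gt0// [leLHS]mulrC.
case: n => [|n]; first by rewrite expr0 fact0 divr1 -[leLHS]expR0 ler_expR.
by apply: le_trans (expR_ge1Dxn n dy0); rewrite lerDr.
Qed.

End real_inequalities.

(** * The dot product as a linear form on row vectors *)

Section dotp_theory.
Context {R : realType} {p : nat}.
Implicit Types x y z : 'rV[R]_p.

Lemma dotpDl x y z : dotp (x + y) z = dotp x z + dotp y z.
Proof. by rewrite -big_split/=; apply: eq_bigr => i _; rewrite mxE mulrDl. Qed.

Lemma dotpZl a x z : dotp (a *: x) z = a * dotp x z.
Proof. by rewrite mulr_sumr; apply: eq_bigr => i _; rewrite mxE mulrA. Qed.

Lemma dotpNr x z : dotp x (- z) = - dotp x z.
Proof. by rewrite -sumrN; apply: eq_bigr => i _; rewrite mxE mulrN. Qed.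

Lemma dotp_delta i z : dotp (delta_mx 0 i) z = z 0 i.
Proof.
rewrite /dotp (bigD1 i)//= !mxE !eqxx mul1r big1 ?addr0// => j ji.
by rewrite mxE (negbTE ji) andbF mul0r.
Qed.

Lemma normr_coord_le x i : `|x 0 i| <= `|x|.
Proof.
rewrite -[leRHS]/(mx_norm x) mx_normrE.
exact: (le_bigmax _ (fun ij : 'I_1 * 'I_p => `|x ij.1 ij.2|) (ord0, i)).
Qed.

(** Here [|x|] is the sup norm, so its dual, the l1 norm, falls on [z]. *)
Lemma normr_dotp_le x z : `|dotp x z| <= `|x| * \sum_i `|z 0 i|.
Proof.
rewrite mulr_sumr (le_trans (ler_norm_sum _ _ _))// ler_sum// => i _.
by rewrite normrM ler_wpM2r// normr_coord_le.
Qed.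

(** The first argument is the variable, so that [dotpr z] can serve as the differential of a
    function with gradient [z]. *)
Definition dotpr z : 'rV[R]_p -> R := fun x => dotp x z.

Lemma dotpr_is_linear z : linear (dotpr z).
Proof. by move=> a x y; rewrite /dotpr dotpDl dotpZl. Qed.

HB.instance Definition _ z :=
  GRing.isLinear.Build R 'rV[R]_p R _ (dotpr z) (dotpr_is_linear z).

End dotp_theory.

(** * Frechet differentiability criteria and smoothness by closure under partial derivatives *)

Section differentiability.
Context {R : realType} {p : nat}.
Implicit Types (f g : 'rV[R]_p -> R) (x c : 'rV[R]_p) (U : set 'rV[R]_p).

(** A remainder of order |h|^2 is o(|h|), and a continuous linear first-order term is unique, hence
    is the differential. *)
Lemma is_diff_quadratic_remainder f x c K rho : 0 < rho ->
  (forall h : 'rV[R]_p, `|h| < rho ->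
    `|f (h + x) - f x - dotp h c| <= K * `|h| ^+ 2) ->
  is_diff x f (dotpr c).
Proof.
move=> rho0 fK.
have cl : continuous (dotpr c).
  apply/linear_bounded_continuous.
  exists (\sum_i `|c 0 i|); split=> [|M ltM]; first exact: num_real.
  have : \forall h \near (0 : 'rV[R]_p), `|h| <= 1 by exact: nbhs0_le.
  apply: filterS => h h1; rewrite /= (le_trans (normr_dotp_le h c))//.
  by rewrite (le_trans _ (ltW ltM))// ler_piMl// sumr_ge0.
have fe : f \o shift x = cst (f x) + dotpr c +o_ (0 : 'rV[R]_p) id.
  apply/eqaddoP => e e0.
  have hrho : \forall h \near (0 : 'rV[R]_p), `|h| < rho by exact: nbhs0_lt.
  (* For K <= 0 the bound is nonpositive and already below e |h|; the radius e / K makes sense only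
     for K > 0. *)
  have [K0|K0] := leP K 0.
    apply: filterS hrho => h hr; rewrite !fctE/= opprD addrA.
    rewrite (le_trans (fK _ hr))// (@le_trans _ _ 0)//.
      by rewrite mulr_le0_ge0// exprn_ge0.
    by rewrite mulr_ge0// ltW.
  have : \forall h \near (0 : 'rV[R]_p), `|h| <= e / K.
    by apply: nbhs0_le; rewrite divr_gt0.
  apply: filterS2 hrho => h hr; rewrite !fctE/= opprD addrA => he.
  rewrite (le_trans (fK _ hr))// expr2 mulrA ler_wpM2r//.
  by rewrite mulrC -ler_pdivlMr.
have dfE := diff_unique cl fe.
by split=> //; apply/diff_locallyP; rewrite dfE.
Qed.

Lemma partialE f x (df : 'rV[R]_p -> R) i :
  is_diff x f df -> partial f i x = df (delta_mx 0 i).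
Proof. by move=> [dfx <-]; rewrite /partial deriveE. Qed.

Lemma differentiable_near_eq f g x : {near x, f =1 g} ->
  differentiable f x -> differentiable g x.
Proof.
move=> fg dfx; have gx : f x = g x by exact: nbhs_singleton fg.
have dfc : continuous ('d f x : 'rV[R]_p -> R) by exact: diff_continuous.
have fgx : \forall h \near (0 : 'rV[R]_p), f (h + x) = g (h + x).
  have := fg; rewrite (near_shift 0 x) /=.
  by apply: filterS => h; rewrite /= subr0.
have ge : g \o shift x = cst (g x) + 'd f x +o_ (0 : 'rV[R]_p) id.
  apply/eqaddoP => e e0.
  have /eqaddoP/(_ e e0) := diff_locally dfx.
  by apply: filterS2 fgx => h /=; rewrite !fctE/= gx => ->.
by apply/diff_locallyP; rewrite (diff_unique dfc ge).
Qed.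

(** Induction on k. A partial derivative agrees with a member of [S] only on [U], so the induction
    runs over all functions equal on [U] to a member of [S]. As [U] is open, such an equality holds
    near each point of [U] and therefore passes to derivatives. *)
Lemma Ck_stable (S : ('rV[R]_p -> R) -> Prop) U : open U ->
  (forall f, S f -> forall x, U x -> differentiable f x) ->
  (forall f i, S f -> exists2 g, S g & {in U, partial f i =1 g}) ->
  forall f, S f -> Cinfty U f.
Proof.
move=> oU dS pS f Sf k.
have {Sf}[g Sg fg] : exists2 g, S g & {in U, f =1 g} by exists f.
have nearU (x : 'rV[R]_p) : x \in U -> \forall y \near x, y \in U.
  by rewrite inE => Ux; apply: filterS (open_nbhs_nbhs (conj oU Ux)) => y /mem_set.
have dU (f' g' : 'rV[R]_p -> R) : {in U, f' =1 g'} -> S g' ->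
    {in U, forall x, differentiable f' x}.
  move=> fg' Sg' x Ux; apply: (@differentiable_near_eq g').
    by apply: filterS (nearU _ Ux) => y /fg' ->.
  by apply: dS; rewrite ?inE in Ux *.
elim: k f g Sg fg => [|k IH] f g Sg fg /=.
  by move=> x Ux; apply: differentiable_continuous; exact: dU fg Sg _ Ux.
split=> [|i]; first exact: dU fg Sg.
have [g' Sg' gg'] := pS g i Sg; apply: (IH _ g') => // x Ux.
rewrite -gg'//; apply: near_eq_derive.
by apply: filterS (nearU _ Ux) => y /fg.
Qed.

End differentiability.

(** * Integrals of finite sums and integrability of nonnegative functions *)

Lemma Rintegral_sum {d} {T : measurableType d} {R : realType}
    (mu : {measure set T -> \bar R}) (I : Type) (r : seq I) (f : I -> T -> R) :
  (forall i, mu.-integrable setT (EFin \o f i)) ->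
  (\int[mu]_x (\sum_(i <- r) f i x))%R = \sum_(i <- r) (\int[mu]_x f i x)%R.
Proof.
move=> fi; elim: r => [|i r IH].
  by under eq_Rintegral do rewrite big_nil; rewrite big_nil Rintegral_cst ?mul0r.
under eq_Rintegral do rewrite big_cons.
rewrite big_cons RintegralD//; first by rewrite IH.
rewrite [X in _.-integrable _ X](_ : _ = (fun x => \sum_(i <- r) (f i x)%:E)%E).
  by apply: integrable_sum => // j _; exact: fi.
by apply/funext => x/=; rewrite sumEFin.
Qed.

Lemma ge0_integrableP {d} {T : measurableType d} {R : realType}
    (mu : {measure set T -> \bar R}) (f : T -> R) :
  measurable_fun setT f -> (forall x, 0 <= f x) ->
  mu.-integrable setT (fun x => (f x)%:E) <-> (\int[mu]_x (f x)%:E < +oo)%E.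
Proof.
move=> mf f0; have absE : (\int[mu]_x `|(f x)%:E| = \int[mu]_x (f x)%:E)%E.
  by apply: eq_integral => x _; rewrite gee0_abs ?lee_fin.
split=> [/integrableP[_]|foo]; first by rewrite absE.
by apply/integrableP; split; [exact/measurable_EFinP|rewrite absE].
Qed.

(** * Moments of an exponential family and differentiation under the integral *)

Section exponential_family.
Context {d} {T : measurableType d} {R : realType}
  (mu : {measure set T -> \bar R}) {p : nat} (F : T -> 'rV[R]_p).
Hypothesis mF : forall i, measurable_fun setT (fun x => F x 0 i).
Implicit Types (theta h : 'rV[R]_p) (s : seq 'I_p).

(** Convertible to [Theta] when the space is [borelRV R d], so results stated for it apply there
    directly. *)
Definition natural_domain : set 'rV[R]_p :=
  [set theta | (\int[mu]_x (expR (- dotp theta (F x)))%:E < +oo)%E].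

Local Notation D := (interior natural_domain).

Definition l1F x : R := \sum_i `|F x 0 i|.

(** On the interior of the domain this is, up to the sign (-1)^|s|, the iterated partial derivative
    of the partition function along the indices in [s]; [moment [::]] is the partition function. *)
Definition moment s theta : R :=
  (\int[mu]_x (\prod_(i <- s) F x 0 i * expR (- dotp theta (F x))))%R.

Lemma l1F_ge0 x : 0 <= l1F x. Proof. exact: sumr_ge0. Qed.

Lemma coord_le_l1F x i : `|F x 0 i| <= l1F x.
Proof. by rewrite /l1F (bigD1 i)//= lerDl sumr_ge0. Qed.

Lemma normr_prod_le_l1F s x : `|\prod_(i <- s) F x 0 i| <= l1F x ^+ size s.
Proof.
elim: s => [|i s IH]; first by rewrite big_nil normr1.
by rewrite big_cons normrM exprS ler_pM// coord_le_l1F.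
Qed.

Lemma measurable_dotpF theta : measurable_fun setT (fun x => dotp theta (F x)).
Proof. by apply: measurable_sum => i; exact: measurable_funM. Qed.

Lemma measurable_l1F : measurable_fun setT l1F.
Proof. by apply: measurable_sum => i; exact: measurableT_comp. Qed.

Lemma measurable_expR_dotpF theta :
  measurable_fun setT (fun x => expR (- dotp theta (F x))).
Proof.
apply: measurableT_comp => //; apply: measurableT_comp => //.
exact: measurable_dotpF.
Qed.

Lemma measurable_prodF s : measurable_fun setT (fun x => \prod_(i <- s) F x 0 i).
Proof. by apply: measurable_prod => i _; exact: mF. Qed.

Lemma natural_domain_integrable theta : natural_domain theta <->
  mu.-integrable setT (fun x => (expR (- dotp theta (F x)))%:E).
Proof.
by apply: iff_sym; apply: ge0_integrableP => [|x];
  [exact: measurable_expR_dotpF|exact: expR_ge0].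
Qed.

(* [exp (delta |F|_1)] is at most the sum of [exp (delta <e, F>)] over the sign
   vectors [e], and each [theta - delta e] is still in the domain. *)
Lemma interior_integrable_l1F theta : D theta ->
  exists2 delta : R, 0 < delta & mu.-integrable setT
    (fun x => (expR (delta * l1F x - dotp theta (F x)))%:E).
Proof.
move=> /nbhs_normP[e /= e0 eD]; exists (e / 2); first by rewrite divr_gt0.
pose sg (b : {ffun 'I_p -> bool}) : 'rV[R]_p := \row_i (-1) ^+ b i.
have sgi b : mu.-integrable setT
    (fun x => (expR (- dotp (theta - (e / 2) *: sg b) (F x)))%:E).
  apply/natural_domain_integrable/eD => /=.
  rewrite opprB addrC subrK normrZ gtr0_norm ?divr_gt0//.
  have : `|sg b| <= 1.
    rewrite -[leLHS]/(mx_norm (sg b)) mx_normrE; apply/bigmax_leP.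
    by split=> // ij _; rewrite mxE normrX normrN1 expr1n.
  move/(ler_wpM2l (ltW (divr_gt0 e0 (ltr0Sn R 1)))); rewrite mulr1.
  move=> /le_lt_trans; apply.
  by rewrite ltr_pdivrMr// ltr_pMr// ltr1n.
apply: (le_integrable measurableT _ _ (@integrable_sum _ _ _ mu _ measurableT
  _ (index_enum _) xpredT _ (fun b _ => sgi b))).
  apply/measurable_EFinP; apply: measurableT_comp => //.
  apply: measurable_funB; last exact: measurable_dotpF.
  by apply: measurable_funM => //; exact: measurable_l1F.
move=> x _; rewrite sumEFin !abse_EFin lee_fin !ger0_norm ?expR_ge0//; last first.
  by rewrite sumr_ge0// => b _; exact: expR_ge0.
pose b : {ffun 'I_p -> bool} := [ffun i => F x 0 i < 0].
have -> : expR (e / 2 * l1F x - dotp theta (F x)) =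
    expR (- dotp (theta - (e / 2) *: sg b) (F x)).
  congr expR; rewrite dotpDl opprD addrC; congr (_ + _).
  rewrite -scaleNr dotpZl mulNr opprK; congr (_ * _).
  apply: eq_bigr => i _; rewrite !mxE ffunE.
  case: ltrP => Fi; first by rewrite ltr0_norm// expr1 mulN1r.
  by rewrite ger0_norm// expr0 mul1r.
by rewrite (bigD1 b)//= lerDl sumr_ge0// => c _; exact: expR_ge0.
Qed.

(** Of the available exponent e, one half absorbs the power of [l1F] through [exprn_le_expR] and the
    other half is kept as delta. *)
Lemma interior_integrable_exprn_l1F n theta : D theta ->
  exists2 delta : R, 0 < delta & mu.-integrable setT
    (fun x => (l1F x ^+ n * expR (delta * l1F x - dotp theta (F x)))%:E).
Proof.
move=> /interior_integrable_l1F[e e0 ei]; exists (e / 2); first by rewrite divr_gt0.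
have e20 : 0 < e / 2 by rewrite divr_gt0.
have [C C0 Cn] := exprn_le_expR n _ e20.
apply: (le_integrable measurableT _ _ (integrableZl measurableT C ei)).
  apply/measurable_EFinP; apply: measurable_funM.
    exact/measurable_funX/measurable_l1F.
  apply: measurableT_comp => //.
  apply: measurable_funB; last exact: measurable_dotpF.
  by apply: measurable_funM => //; exact: measurable_l1F.
move=> x _; rewrite -EFinM !abse_EFin lee_fin !normrM.
rewrite (ger0_norm C0) !(ger0_norm (expR_ge0 _)) ger0_norm ?exprn_ge0 ?l1F_ge0//.
apply: le_trans (ler_wpM2r (expR_ge0 _) (Cn _ (l1F_ge0 x))) _.
by rewrite -(mulrA C) -expRD addrA -mulrDl -splitr.
Qed.

Lemma moment_integrable s theta : D theta -> mu.-integrable setT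
  (fun x => (\prod_(i <- s) F x 0 i * expR (- dotp theta (F x)))%:E).
Proof.
move=> /(interior_integrable_exprn_l1F (size s))[e e0 ei].
apply: (le_integrable measurableT _ _ ei).
  apply/measurable_EFinP; apply: measurable_funM; first exact: measurable_prodF.
  exact: measurable_expR_dotpF.
move=> x _; rewrite !abse_EFin lee_fin !normrM !(ger0_norm (expR_ge0 _)).
rewrite ler_pM ?expR_ge0// ?ler_expR.
  by rewrite (le_trans (normr_prod_le_l1F _ _))// ler_norm.
by rewrite lerDr mulr_ge0 ?l1F_ge0// ltW.
Qed.

Let dotp_momentE s theta h x :
  \prod_(i <- s) F x 0 i * dotp h (F x) * expR (- dotp theta (F x)) =
  \sum_i h 0 i * (\prod_(j <- i :: s) F x 0 j * expR (- dotp theta (F x))).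
Proof.
rewrite /dotp mulr_sumr mulr_suml; apply: eq_bigr => i _.
by rewrite big_cons; ring.
Qed.

Lemma dotp_moment_integrable s theta h : D theta -> mu.-integrable setT
  (fun x => (\prod_(i <- s) F x 0 i * dotp h (F x) *
             expR (- dotp theta (F x)))%:E).
Proof.
move=> Dth; under eq_fun do rewrite dotp_momentE -sumEFin.
apply: integrable_sum => // i _; under eq_fun do rewrite EFinM.
exact/integrableZl/moment_integrable.
Qed.

(** Turns the first-order term of the expansion of [moment s] into one integral, ready to be merged
    with the increment. *)
Lemma dotp_moment s theta h : D theta ->
  dotp h (\row_i moment (i :: s) theta) =
  (\int[mu]_x (\prod_(i <- s) F x 0 i * dotp h (F x) *
               expR (- dotp theta (F x))))%R.
Proof.
move=> Dth; under eq_Rintegral do rewrite dotp_momentE.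
rewrite Rintegral_sum => [|i]; last first.
  exact: (integrableZl measurableT (h 0 i) (moment_integrable _ _ Dth)).
apply: eq_bigr => i _; rewrite mxE RintegralZl//.
exact: moment_integrable.
Qed.

Lemma is_diff_moment s theta : D theta ->
  is_diff theta (moment s) (dotpr (- \row_i moment (i :: s) theta)).
Proof.
move=> Dth; have [rho rho0 rhoi] := interior_integrable_exprn_l1F (size s).+2 _ Dth.
have /nbhs_normP[e /= e0 eD] : nbhs theta D.
  by apply: open_nbhs_nbhs; split => //; exact: open_interior.
(* K is the integral of the dominating function. The bound |h| < e keeps h + theta in the domain,
   and |h| < rho lets exp (|h| [l1F]) be absorbed into exp (rho [l1F]). *)
apply: (@is_diff_quadratic_remainder _ _ _ _ _
  (\int[mu]_x (l1F x ^+ (size s).+2 * expR (rho * l1F x - dotp theta (F x))))%R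
  (Num.min e rho)); first by rewrite lt_min e0.
move=> h; rewrite lt_min => /andP[he hrho].
have Dh : D (h + theta).
  by apply: eD => /=; rewrite opprD addrCA subrr addr0 normrN.
rewrite dotpNr opprK dotp_moment// -[_ - moment s theta]RintegralB//;
  [|exact: moment_integrable..].
rewrite -RintegralD//; [|exact: integrableB (moment_integrable _ _ _)
     (moment_integrable _ _ _)
  |exact: dotp_moment_integrable].
set r := (X in (\int[mu]_x X x)%R).
have ri : mu.-integrable setT (EFin \o r).
  have ri0 := integrableB measurableT (moment_integrable s _ Dh)
    (moment_integrable s _ Dth).
  exact: (integrableD measurableT ri0 (dotp_moment_integrable s theta h Dth)).
apply: le_trans (le_normr_Rintegral measurableT ri) _.
rewrite -RintegralZr//; apply: le_Rintegral => //.
- exact: integrable_norm.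
- exact: (integrableZr measurableT _ rhoi).
move=> x _; rewrite /r.
set P := \prod_(i <- s) _; set u := dotp theta (F x).
(* Factoring out P exp (- u) leaves the exponential remainder at y = - <h, F x>. The factor y^2 in
   [expR_remainder] supplies |h|^2 and two extra powers of [l1F], whence the exponent |s| + 2. *)
have -> : P * expR (- dotp (h + theta) (F x)) - P * expR (- u) +
    P * dotp h (F x) * expR (- u) =
    P * expR (- u) * (expR (- dotp h (F x)) - 1 - (- dotp h (F x))).
  by rewrite dotpDl opprD expRD -/u; ring.
rewrite normrM (le_trans (ler_wpM2l (normr_ge0 _) (expR_remainder _)))//.
rewrite sqrrN normrN normrM (ger0_norm (expR_ge0 _)).
set a := dotp h (F x).
have ha : `|a| <= `|h| * l1F x by exact: normr_dotp_le.
have -> : l1F x ^+ (size s).+2 * expR (rho * l1F x - u) * `|h| ^+ 2 =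
    l1F x ^+ size s * expR (- u) * ((`|h| * l1F x) ^+ 2 * expR (rho * l1F x)).
  by rewrite expRD !exprS; ring.
rewrite ler_pM ?(mulr_ge0 (sqr_ge0 _) (expR_ge0 _)) ?mulr_ge0 ?expR_ge0//.
  by rewrite ler_wpM2r ?expR_ge0// normr_prod_le_l1F.
rewrite ler_pM ?sqr_ge0 ?expR_ge0//.
  by rewrite -real_normK ?num_real// lerXn2r// nnegrE mulr_ge0// l1F_ge0.
by rewrite ler_expR (le_trans ha)// ler_wpM2r ?l1F_ge0// ltW.
Qed.

End exponential_family.

(** * Smoothness of the log-partition function *)

Section log_moment_generating.
Context {d} {T : measurableType d} {R : realType}
  (mu : probability T R) {p : nat} (F : T -> 'rV[R]_p).
Hypothesis mF : forall i, measurable_fun setT (fun x => F x 0 i).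
Implicit Types (theta : 'rV[R]_p) (s : seq 'I_p).

Local Notation D := (interior (natural_domain mu F) : set 'rV[R]_p).
Local Notation moment := (moment mu F).

Lemma moment_nilE theta :
  moment [::] theta = (\int[mu]_x expR (- dotp theta (F x)))%R.
Proof. by apply: eq_Rintegral => x _; rewrite big_nil mul1r. Qed.

(** Were the integral zero, the exponential would vanish almost everywhere, hence somewhere, since
    [mu] has mass 1. *)
Lemma moment_nil_gt0 theta : natural_domain mu F theta -> 0 < moment [::] theta.
Proof.
move=> /(natural_domain_integrable _ _ mF) thi; rewrite moment_nilE.
rewrite lt_neqAle Rintegral_ge0 ?andbT; last by move=> x _; exact: expR_ge0.
apply/eqP => /esym Z0; have Z0E : (\int[mu]_x (expR (- dotp theta (F x)))%:E = 0)%E.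
  by rewrite -[LHS]fineK ?(integrable_fin_num measurableT thi)// [fine _]Z0.
have /(ae_eq_integral_abs mu measurableT (measurable_int _ thi)) f0 :
    (\int[mu]_x `|(expR (- dotp theta (F x)))%:E| = 0)%E.
  rewrite -[RHS]Z0E; apply: eq_integral => x _.
  by rewrite gee0_abs// lee_fin expR_ge0.
have mu_gt0 : (0 < mu setT)%E by rewrite probability_setT.
have := @filter_ex _ _ (ae_properfilter_algebraOfSetsType mu_gt0) _ f0.
by move=> [x /(_ I) [/eqP]]; rewrite gt_eqF// expR_gt0.
Qed.

(** Built as an inductive closure so that differentiability and stability under [partial] are proved
    by induction on the construction. The reciprocal is a generator because it appears in the
    partial derivatives of the logarithm. *)
Inductive moment_algebra : ('rV[R]_p -> R) -> Prop :=
| MA_moment s : moment_algebra (moment s)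
| MA_inv : moment_algebra (fun theta => (moment [::] theta)^-1)
| MA_ln : moment_algebra (fun theta => ln (moment [::] theta))
| MA_opp f : moment_algebra f -> moment_algebra (- f)
| MA_add f g : moment_algebra f -> moment_algebra g -> moment_algebra (f + g)
| MA_mul f g : moment_algebra f -> moment_algebra g -> moment_algebra (f * g).

Lemma is_diff_ln_moment theta : D theta ->
  is_diff theta (fun theta => ln (moment [::] theta))
    ((moment [::] theta)^-1 *: dotpr (- \row_i moment [:: i] theta)).
Proof.
move=> Dth.
have dm := is_diff_moment mu F mF [::] _ Dth.
have Z0 := moment_nil_gt0 _ (interior_subset Dth).
have [/derivable1_diffP dl lE] := is_derive1_ln Z0.
have {}dl : is_diff (moment [::] theta) (@ln R) ( *:%R^~ (moment [::] theta)^-1).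
  by apply: DiffDef => //; rewrite deriv1E ?derive1E ?lE//; exact/derivable1_diffP.
have [] := is_diff_comp dm dl; rewrite /comp => ml mlE; apply: DiffDef => //.
by rewrite mlE; apply/funext => h; rewrite !fctE [RHS]mulrC.
Qed.

Lemma moment_algebra_differentiable f : moment_algebra f -> forall theta, D theta ->
  differentiable f theta.
Proof.
move=> mf theta Dth.
have Z0 := moment_nil_gt0 _ (interior_subset Dth).
have dm s : differentiable (moment s) theta.
  by have [] := is_diff_moment mu F mF s _ Dth.
elim: mf => {f}.
- exact: dm.
- by apply: differentiableV => //; rewrite gt_eqF.
- by have [] := is_diff_ln_moment _ Dth.
- by move=> f _; exact: differentiableN.
- by move=> f g _ df _ dg; exact: differentiableD.
- by move=> f g _ df _ dg; exact: differentiableM.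
Qed.

Lemma partial_moment s i theta : D theta ->
  partial (moment s) i theta = - moment (i :: s) theta.
Proof.
move=> Dth; rewrite (partialE _ _ _ _ (is_diff_moment mu F mF s _ Dth)).
by rewrite /dotpr dotp_delta !mxE.
Qed.

Lemma partial_ln_moment i theta : D theta ->
  partial (fun theta => ln (moment [::] theta)) i theta =
  - moment [:: i] theta * (moment [::] theta)^-1.
Proof.
move=> Dth; rewrite (partialE _ _ _ _ (is_diff_ln_moment _ Dth)).
by rewrite !fctE /dotpr dotp_delta !mxE mulrC.
Qed.

Lemma moment_algebra_partial f i : moment_algebra f ->
  exists2 g, moment_algebra g & {in D, partial f i =1 g}.
Proof.
have drv g theta : moment_algebra g -> theta \in D ->
    derivable g theta (delta_mx 0 i).
  by move=> Mg; rewrite inE => Dth;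
    apply/diff_derivable/moment_algebra_differentiable.
elim => {f}[s|||f Mf [f' Mf' ff']|f g Mf [f' Mf' ff'] Mg [g' Mg' gg']
  |f g Mf [f' Mf' ff'] Mg [g' Mg' gg']].
- exists (- moment (i :: s)); first exact/MA_opp/MA_moment.
  by move=> theta; rewrite inE; exact: partial_moment.
(* With Z = [moment [::]], the derivative of 1 / Z is - (d_i Z) / Z^2 and d_i Z = - [moment [:: i]],
   so the signs cancel. *)
- exists (moment [:: i] * ((fun theta => (moment [::] theta)^-1)
                           * (fun theta => (moment [::] theta)^-1))).
    by do 2?apply: MA_mul; [exact: MA_moment|exact: MA_inv|exact: MA_inv].
  move=> theta Dth; have Dth' : D theta by rewrite inE in Dth.
  have Z0 : moment [::] theta != 0.
    by rewrite gt_eqF// moment_nil_gt0//; exact: interior_subset.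
  rewrite /partial deriveV//; last exact: drv (MA_moment _) Dth.
  rewrite -/(partial (moment [::]) i theta) partial_moment//.
  by rewrite scalerN scaleNr opprK !fctE -[LHS]/(_ * _) -exprVn expr2 mulrC.
- exists (- moment [:: i] * (fun theta => (moment [::] theta)^-1)).
    by apply: MA_mul; [exact/MA_opp/MA_moment|exact: MA_inv].
  by move=> theta; rewrite inE; exact: partial_ln_moment.
- exists (- f'); first exact: MA_opp.
  move=> theta Dth; rewrite /partial deriveN; last exact: drv.
  by rewrite [X in - X](ff' _ Dth).
- exists (f' + g'); first exact: MA_add.
  move=> theta Dth; rewrite /partial deriveD; [|exact: drv..].
  by rewrite [X in X + _](ff' _ Dth) [X in _ + X](gg' _ Dth).
- exists (f * g' + g * f'); first by apply: MA_add; exact: MA_mul.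
  move=> theta Dth; rewrite /partial deriveM; [|exact: drv..].
  by rewrite [X in _ *: X + _](gg' _ Dth) [X in _ + _ *: X](ff' _ Dth).
Qed.

Lemma Cinfty_ln_moment : Cinfty D (fun theta => ln (moment [::] theta)).
Proof.
apply: (Ck_stable moment_algebra) MA_ln.
- exact: open_interior.
- exact: moment_algebra_differentiable.
- by move=> f i; exact: moment_algebra_partial.
Qed.

End log_moment_generating.

(** * Densities with respect to [mu] and change of measure *)

Section density.
Context {d} {T : measurableType d} {R : realType} (mu : probability T R).
Implicit Types (pi nu : probability T R) (r g : T -> R).
Local Open Scope charge_scope.
Local Open Scope ereal_scope.

(** A version of the Radon-Nikodym derivative that is real and nonnegative at every point, so that
    pointwise inequalities apply without exceptional sets. *)
Definition has_density pi r := [/\ measurable_fun setT r,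
  forall x, (0 <= r x)%R &
  forall A, measurable A -> pi A = \int[mu]_(x in A) (r x)%:E].

Lemma has_density_dominates pi r : has_density pi r -> pi `<< mu.
Proof.
move=> [mr _ piE]; apply/null_content_dominatesP => A mA A0.
by rewrite piE// null_set_integral//; apply/measurable_EFinP/measurable_funTS.
Qed.

Lemma dominates_has_density pi : pi `<< mu -> exists r, has_density pi r.
Proof.
move=> pimu; pose f := Radon_Nikodym_SigmaFinite.f pi mu.
have fE x : (fine (f x))%:E = f x.
  by rewrite fineK// Radon_Nikodym_SigmaFinite.f_fin_num.
exists (fine \o f); split=> [|x|A mA].
- apply: measurableT_comp => //.
  exact: measurable_int (Radon_Nikodym_SigmaFinite.f_integrable pimu).
- by rewrite fine_ge0// Radon_Nikodym_SigmaFinite.f_ge0.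
- rewrite (Radon_Nikodym_SigmaFinite.f_integral pimu)//.
  by apply: eq_integral => x _; rewrite /= fE.
Qed.

Lemma has_density_integrable pi r : has_density pi r ->
  mu.-integrable setT (EFin \o r).
Proof.
move=> [mr r0 piE]; apply/integrableP; split; first exact/measurable_EFinP.
rewrite (eq_integral (EFin \o r)) => [|x _]; last by rewrite gee0_abs ?lee_fin.
by rewrite -piE// probability_setT ltry.
Qed.

(** Both functions integrate to [pi] on every measurable set. *)
Lemma has_density_ae_eq pi r : has_density pi r ->
  ae_eq mu setT (EFin \o r) ('d (charge_of_finite_measure pi) '/d mu).
Proof.
move=> hr; have pimu := has_density_dominates _ _ hr.
have [mr r0 piE] := hr.
apply: integral_ae_eq => //; first exact: has_density_integrable hr.
by move=> A _ mA; rewrite -Radon_Nikodym_integral//= -piE.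
Qed.

Lemma KL_has_density pi r : has_density pi r ->
  KL pi mu = \int[mu]_x (r x * ln (r x))%:E.
Proof.
move=> hr; have pimu := has_density_dominates _ _ hr.
have [mr r0 piE] := hr.
have mxlnx : measurable_fun setT (fun x : R => x * ln x)%R.
  by apply: measurable_funM => //; exact: measurable_ln.
rewrite /KL asboolT//; apply: ae_eq_integral => //.
- apply/measurable_EFinP; apply: (measurableT_comp mxlnx).
  by apply: measurableT_comp => //.
- by apply/measurable_EFinP; exact: (measurableT_comp mxlnx).
- by apply: filterS (has_density_ae_eq _ _ hr) => x /(_ I) /= <-.
Qed.

(** The nonnegative case assumes no integrability of [f]; applied to |f| it transfers integrability
    between [pi] and [mu]. *)
Lemma ge0_integral_has_density pi r (f : T -> R) : has_density pi r ->
  measurable_fun setT f -> (forall x, 0 <= f x)%R ->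
  \int[pi]_x (f x)%:E = \int[mu]_x (f x * r x)%:E.
Proof.
move=> hr mf f0; have pimu := has_density_dominates _ _ hr.
have [mr r0 piE] := hr.
rewrite -(Radon_Nikodym_SigmaFinite.change_of_variables pimu)//;
  [|exact/measurable_EFinP].
apply: ae_eq_integral => //.
- apply: emeasurable_funM; first exact/measurable_EFinP.
  exact: measurable_int (Radon_Nikodym_SigmaFinite.f_integrable pimu).
- by apply/measurable_EFinP; exact: measurable_funM.
apply: filterS2 (ae_eq_Radon_Nikodym_SigmaFinite pimu measurableT)
  (has_density_ae_eq _ _ hr) => x /(_ I) -> /(_ I) <- _.
by rewrite EFinM.
Qed.

Lemma integrable_has_density pi r (f : T -> R) : has_density pi r ->
  measurable_fun setT f -> pi.-integrable setT (EFin \o f) <->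
  mu.-integrable setT (fun x => (f x * r x)%:E).
Proof.
move=> hr mf; have [mr r0 _] := hr.
have absE : \int[pi]_x `|(f x)%:E| = \int[mu]_x `|(f x * r x)%:E|.
  under eq_integral do rewrite abse_EFin.
  rewrite (ge0_integral_has_density _ _ _ hr)//; last exact: measurableT_comp.
  by apply: eq_integral => x _; rewrite abse_EFin normrM (ger0_norm (r0 x)).
split=> /integrableP[mfr foo]; apply/integrableP.
  by split; [apply/measurable_EFinP; exact: measurable_funM|rewrite -absE].
by split; [exact/measurable_EFinP|rewrite /= absE].
Qed.

Lemma integral_has_density pi r (f : T -> R) : has_density pi r ->
  pi.-integrable setT (EFin \o f) ->
  \int[pi]_x (f x)%:E = \int[mu]_x (f x * r x)%:E.
Proof.
move=> hr fi; have pimu := has_density_dominates _ _ hr.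
have [mr r0 _] := hr; have /measurable_EFinP mf := measurable_int _ fi.
rewrite -(Radon_Nikodym_change_of_variables pimu)//.
apply: ae_eq_integral => //.
- by apply: emeasurable_funM => //; exact/measurable_EFinP.
- by apply/measurable_EFinP; exact: measurable_funM.
by apply: filterS (has_density_ae_eq _ _ hr) => x /(_ I) /= <- _; rewrite EFinM.
Qed.

End density.

(** * The pointwise form of the Gibbs inequality *)

Section gibbs_inequality.
Context {R : realType}.
Implicit Types x y : R.

(** The Bregman divergence of t ln t: the gap at x between this convex function and its tangent at
    y. *)
Definition bregman x y : R := x * ln x - (x * ln y + x - y).

Lemma ln_lt_subr1 x : 0 < x -> x != 1 -> ln x < x - 1.
Proof.
move=> x0 x1; rewrite -ltr_expR lnK//.
have : x - 1 != 0 by rewrite subr_eq0.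
by move/expR_gt1Dx; lra.
Qed.

(** For x > 0, apply ln t < t - 1 at t = y / x and multiply by x; at x = 0 the value is y. *)
Lemma bregman_gt0 x y : 0 <= x -> 0 < y -> x != y -> 0 < bregman x y.
Proof.
rewrite le_eqVlt => /predU1P[<-|x0] y0 xy; rewrite /bregman.
  by rewrite !mul0r; lra.
have yx1 : y / x != 1.
  by apply: contra xy => /eqP yx; rewrite -(divfK (negbT (gt_eqF x0)) y) yx mul1r.
have := ln_lt_subr1 _ (divr_gt0 y0 x0) yx1.
rewrite ln_div// -(ltr_pM2l x0) !mulrBr mulrCA divff ?gt_eqF// !mulr1.
lra.
Qed.

Lemma bregman_ge0 x y : 0 <= x -> 0 < y -> 0 <= bregman x y.
Proof.
move=> x0 y0; have [->|xy] := eqVneq x y; last exact/ltW/bregman_gt0.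
by rewrite /bregman; lra.
Qed.

End gibbs_inequality.

(** * Lower bound on the divergence and its equality case *)

Section KL_lower_bound.
Context {d} {T : measurableType d} {R : realType} (mu : probability T R).
Local Open Scope ereal_scope.

(** On a space of mass 1 the negative part has integral at most |c|, so the integral is finite from
    both sides. *)
Lemma integrable_bounded_below (f : T -> R) (c : R) :
  measurable_fun setT f -> (forall x, c <= f x)%R ->
  \int[mu]_x (f x)%:E < +oo -> mu.-integrable setT (EFin \o f).
Proof.
move=> mf cf foo; apply/integrableP; split; first exact/measurable_EFinP.
rewrite (integral_fin_num_abs mu measurableT mf) fin_numE (lt_eqF foo) andbT.
rewrite gt_eqF// integralE.
have fn : \int[mu]_x (EFin \o f)^\- x < +oo.
  apply: (@le_lt_trans _ _ (\int[mu]_x `|c|%R%:E)); last first.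
    by rewrite integral_cst//= [X in _ * X]probability_setT mule1 ltry.
  apply: ge0_le_integral => //; first exact/measurable_funeneg/measurable_EFinP.
  move=> x _; rewrite funenegE /= -EFin_max lee_fin ge_max normr_ge0 andbT.
  by rewrite lerNl (le_trans _ (cf x))// lerNl -normrN ler_norm.
apply: (@lt_le_trans _ _ (- \int[mu]_x (EFin \o f)^\- x)); last first.
  by rewrite leeDr// integral_ge0.
by rewrite lteNr.
Qed.

Lemma KL_lower_bound (pi nu : probability T R) (r g : T -> R) :
  has_density mu pi r -> has_density mu nu g -> (forall x, 0 < g x)%R ->
  pi.-integrable setT (fun x => (ln (g x))%:E) ->
  \int[pi]_x (ln (g x))%:E <= KL pi mu /\
  (KL pi mu = \int[pi]_x (ln (g x))%:E ->
   forall A, measurable A -> pi A = nu A).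
Proof.
move=> hr hg g0 lgi; have [mr r0 piE] := hr; have [mg _ nuE] := hg.
have mlg : measurable_fun setT (fun x => ln (g x)).
  by apply: measurableT_comp => //; exact: measurable_ln.
have ri := has_density_integrable _ _ _ hr.
have gi := has_density_integrable _ _ _ hg.
have lgri := (integrable_has_density _ _ _ _ hr mlg).1 lgi.
(* The tangent term of [bregman]. Since [r] and [g] both integrate to 1, its integral reduces to
   that of ln g against [pi]. *)
pose k x : R := (r x * ln (g x) + r x - g x)%R.
have ki : mu.-integrable setT (EFin \o k).
  have := integrableB measurableT (integrableD measurableT lgri ri) gi.
  by apply: eq_integrable => // x _ /=; rewrite /k mulrC.
have kE : \int[mu]_x (k x)%:E = \int[pi]_x (ln (g x))%:E.
  rewrite (integral_has_density _ _ _ _ hr lgi).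
  have -> : \int[mu]_x (k x)%:E =
      \int[mu]_x (((ln (g x) * r x)%:E + (r x)%:E) - (g x)%:E).
    by apply: eq_integral => x _; rewrite /k mulrC.
  rewrite (integralB measurableT (integrableD measurableT lgri ri) gi).
  rewrite (integralD measurableT lgri ri).
  by rewrite -piE// -nuE// !probability_setT addeK.
(* At +oo the bound is trivial and equality is impossible, the other side being finite. *)
have [->|] := eqVneq (KL pi mu) +oo.
  split; first exact: leey.
  move=> h; have := integrable_fin_num measurableT lgi.
  by rewrite -h.
rewrite (KL_has_density _ _ _ hr) -ltey => KLoo.
have mrlr : measurable_fun setT (fun x => (r x * ln (r x))%R).
  by apply: measurable_funM => //; apply: measurableT_comp => //;
    exact: measurable_ln.
have rlri : mu.-integrable setT (fun x => (r x * ln (r x))%:E).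
  (* The tangent at y = 1 gives r ln r >= r - 1 >= -1. *)
  apply: (integrable_bounded_below _ (-1) mrlr) => // x.
  have := bregman_ge0 _ _ (r0 x) (@ltr01 R); have := r0 x.
  by rewrite /bregman ln1; lra.
have bi := integrableB measurableT rlri ki.
have bE : \int[mu]_x (bregman (r x) (g x))%:E =
    \int[mu]_x (r x * ln (r x))%:E - \int[pi]_x (ln (g x))%:E.
  by rewrite -kE -(integralB measurableT rlri ki).
have b0 x : (0 <= bregman (r x) (g x))%R by exact: bregman_ge0.
split.
  rewrite -sube_ge0 ?(integrable_fin_num measurableT lgi)//.
  by rewrite -bE integral_ge0// => x _; rewrite lee_fin.
move=> KLE; move: bE; rewrite KLE subee ?(integrable_fin_num measurableT lgi)//.
move=> bE0; have /(ae_eq_integral_abs mu measurableT (measurable_int _ bi)) b00 :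
    \int[mu]_x `|(bregman (r x) (g x))%:E| = 0.
  by rewrite -[RHS]bE0; apply: eq_integral => x _; rewrite gee0_abs ?lee_fin.
(* A zero integral makes the nonnegative [bregman] vanish almost everywhere, and strict positivity
   off the diagonal then forces r = g there. *)
have rg : ae_eq mu setT (EFin \o r) (EFin \o g).
  apply: filterS b00 => x /(_ I) [bx0] _ /=; congr _%:E; apply/eqP/negP => /negP rgx.
  by have := bregman_gt0 _ _ (r0 x) (g0 x) rgx; rewrite [bregman _ _]bx0 ltxx.
move=> A mA; rewrite piE// nuE//; apply: ae_eq_integral => //.
- exact/measurable_EFinP/measurable_funTS.
- exact/measurable_EFinP/measurable_funTS.
exact: ae_eq_subset rg.
Qed.

End KL_lower_bound.

(** * Integrability under an interior tilt of a function with an exponential moment *)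

Section interior_moments.
Context {d} {T : measurableType d} {R : realType}
  (mu : {measure set T -> \bar R}) {p : nat} (F : T -> 'rV[R]_p).
Hypothesis mF : forall i, measurable_fun setT (fun x => F x 0 i).

(* With [a = eta t] and [b = - <(1 + k) theta, F>], the convex combination
   [(k a + b) / (1 + k)] is at most [max a b], so [exp (delta t - <theta, F>)] is
   at most [exp a + exp b]; [k] is small enough for [(1 + k) theta] to stay in
   the domain. *)
Lemma interior_integrable_mul (t : T -> R) (eta : R) (theta : 'rV[R]_p) :
  measurable_fun setT t -> (forall x, 0 <= t x) -> 0 < eta ->
  (\int[mu]_x (expR (eta * t x))%:E < +oo)%E ->
  interior (natural_domain mu F) theta ->
  mu.-integrable setT (fun x => (t x * expR (- dotp theta (F x)))%:E).
Proof.
move=> mt t0 eta0 etaoo /nbhs_normP[e /= e0 eD].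
pose k := e / (`|theta| + 1).
have th1 : 0 < `|theta| + 1 by rewrite ltr_wpDl.
have k0 : 0 < k by rewrite divr_gt0.
have k10 : 0 < 1 + k by rewrite addr_gt0.
have bi : mu.-integrable setT
    (fun x => (expR (- dotp ((1 + k) *: theta) (F x)))%:E).
  apply/(natural_domain_integrable mu F mF)/eD => /=.
  rewrite scalerDl scale1r opprD addrA subrr sub0r normrN normrZ gtr0_norm//.
  by rewrite /k mulrAC ltr_pdivrMr// ltr_pM2l// ltrDl.
have ai : mu.-integrable setT (fun x => (expR (eta * t x))%:E).
  have me : measurable_fun setT (fun x => expR (eta * t x)).
    by apply: measurableT_comp => //; exact: measurable_funM.
  exact/(ge0_integrableP mu _ me (fun x => expR_ge0 _)).
pose delta := k * eta / (1 + k).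
have delta0 : 0 < delta by rewrite divr_gt0// mulr_gt0.
apply: (le_integrable measurableT _ _
  (integrableZl measurableT delta^-1 (integrableD measurableT ai bi))).
  apply/measurable_EFinP; apply: measurable_funM => //.
  exact: measurable_expR_dotpF.
move=> x _; rewrite -EFinD -EFinM !abse_EFin lee_fin.
rewrite !ger0_norm ?mulr_ge0 ?addr_ge0 ?expR_ge0// ?invr_ge0 ?(ltW delta0)//.
rewrite -[leRHS]mulrC ler_pdivlMr// dotpZl.
set u := dotp theta (F x).
apply: (@le_trans _ _ (expR (delta * t x) * expR (- u))).
  rewrite mulrAC ler_wpM2r ?expR_ge0// mulrC.
  by rewrite (le_trans _ (expR_ge1Dx _))// lerDr.
rewrite -expRD.
have uE : delta * t x - u = (k * (eta * t x) - (1 + k) * u) / (1 + k).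
  by rewrite /delta; field; rewrite gt_eqF.
have [ab|/ltW ba] := leP (eta * t x) (- ((1 + k) * u)).
- rewrite (@le_trans _ _ (expR (- ((1 + k) * u))))// ?lerDr ?expR_ge0//.
  rewrite ler_expR uE ler_pdivrMr//.
  by have := ler_wpM2l (ltW k0) ab; lra.
- rewrite (@le_trans _ _ (expR (eta * t x)))// ?lerDl ?expR_ge0//.
  by rewrite ler_expR uE ler_pdivrMr//; lra.
Qed.

End interior_moments.

(** * Borel measurability of continuous functions and of powers of the Euclidean norm *)

Section borel_row_vectors.
Context {R : realType} {d p : nat}.

Lemma continuous_borel_measurable (f : 'rV[R]_d -> R) :
  continuous f -> measurable_fun setT (f : borelRV R d -> R).
Proof.
move=> /continuousP cf; apply: (measurability _ (RGenOpens.measurableE R)).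
move=> _ [_ [a [b ->] <-]]; rewrite setTI; apply: sub_sigma_algebra.
exact/cf/interval_open.
Qed.

Lemma continuous_coord_measurable (F : 'rV[R]_d -> 'rV[R]_p) i :
  continuous F -> measurable_fun setT (fun x : borelRV R d => F x 0 i).
Proof.
move=> cF; apply: (@continuous_borel_measurable (fun x => F x 0 i)) => x.
exact: (continuous_comp (cF x) (@coord_continuous _ _ _ _ _ _)).
Qed.

Lemma measurable_enorm_powR (alpha : R) :
  measurable_fun setT (fun x : borelRV R d => enorm x `^ alpha).
Proof.
apply: (measurableT_comp (measurable_powR _)).
apply: (measurableT_comp (continuous_measurable_fun (@sqrt_continuous R))).
apply: measurable_sum => i; apply: measurable_funX.
by apply: (@continuous_borel_measurable (fun x => x 0 i)); exact: coord_continuous.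
Qed.

Lemma normr_coord_le_enorm (x : 'rV[R]_d) i : `|x 0 i| <= enorm x.
Proof.
rewrite -sqrtr_sqr ler_sqrt ?sumr_ge0// => [|j _]; last exact: sqr_ge0.
by rewrite (bigD1 i)//= lerDl sumr_ge0// => j _; exact: sqr_ge0.
Qed.

End borel_row_vectors.

(** * Density and mean of the Gibbs measure, and the gradient identity *)

Section gibbs_measure.
Context {R : realType} {d p : nat} (mu : probability (borelRV R d) R)
  (F : 'rV[R]_d -> 'rV[R]_p) (cF : continuous F).
Implicit Types (theta : 'rV[R]_p).

Let mF i : measurable_fun setT (fun x : borelRV R d => F x 0 i).
Proof. exact: continuous_coord_measurable. Qed.

Local Notation Z := (moment mu F [::]).
Local Notation D := (interior (Theta mu F)).

Lemma logpartitionE : logpartition mu F = fun theta => ln (Z theta).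
Proof. by apply/funext => theta; rewrite moment_nilE. Qed.

Lemma gibbs_densityE theta x : Theta mu F theta ->
  expR (- dotp theta (F x) - logpartition mu F theta) =
  expR (- dotp theta (F x)) / Z theta.
Proof.
move=> th; rewrite expRB logpartitionE lnK// posrE.
exact: (moment_nil_gt0 mu F mF theta th).
Qed.

Lemma gibbs_has_density theta (th : Theta mu F theta) :
  has_density mu (gibbs cF th)
    (fun x => expR (- dotp theta (F x) - logpartition mu F theta)).
Proof.
split=> [|x|A mA]; [|exact: expR_ge0|by []].
apply: measurableT_comp => //; apply: measurable_funB => //.
by apply: measurableT_comp => //; exact: measurable_dotpF.
Qed.

Lemma integrable_gibbs theta (th : Theta mu F theta) (f : borelRV R d -> R) :
  measurable_fun setT f ->
  mu.-integrable setT (fun x => (f x * expR (- dotp theta (F x)))%:E) ->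
  (gibbs cF th).-integrable setT (EFin \o f).
Proof.
move=> mf fi; apply/(integrable_has_density _ _ _ _ (gibbs_has_density _ th) mf).
apply: eq_integrable (integrableZl measurableT (Z theta)^-1 fi) => // x _.
by rewrite gibbs_densityE// -EFinM mulrA mulrC.
Qed.

Lemma mean_gibbs theta (th : D theta) j :
  mean (gibbs cF (interior_subset th)) F j =
    (moment mu F [:: j] theta / Z theta)%:E.
Proof.
have mi := moment_integrable mu F mF [:: j] theta th.
have fi : mu.-integrable setT (fun x => (F x 0 j * expR (- dotp theta (F x)))%:E).
  by apply: eq_integrable mi => // x _; rewrite big_seq1.
have Fi := integrable_gibbs _ (interior_subset th) _ (mF j) fi.
rewrite /mean.
have hg := gibbs_has_density _ (interior_subset th).
rewrite (integral_has_density _ _ _ _ hg Fi).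
have -> : moment mu F [:: j] theta =
    (\int[mu]_x (F x 0 j * expR (- dotp theta (F x))))%R.
  by apply: eq_Rintegral => x _; rewrite big_seq1.
rewrite -RintegralZr// /Rintegral fineK.
  apply: eq_integral => x _; rewrite gibbs_densityE ?mulrA//.
  exact: interior_subset.
apply: integrable_fin_num => //.
exact: (integrableZr measurableT (Z theta)^-1 fi).
Qed.

Lemma grad_logpartition theta (th : D theta) j :
  (grad (logpartition mu F) theta 0 j)%:E =
  (- mean (gibbs cF (interior_subset th)) F j)%E.
Proof.
rewrite (mean_gibbs _ th j) /grad mxE logpartitionE.
by rewrite (partial_ln_moment mu F mF j theta th) mulNr.
Qed.

(** ln g is affine in [F], namely - <theta, F> - L(theta); the zero mean removes the linear part, so
    every admissible measure yields the same constant. *)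
Lemma integral_ln_gibbs (pi : probability (borelRV R d) R) theta :
  (forall j, pi.-integrable setT (fun x => (F x 0 j)%:E)) ->
  (forall j, mean pi F j = 0%E) ->
  let g x := expR (- dotp theta (F x) - logpartition mu F theta) in
  pi.-integrable setT (fun x => (ln (g x))%:E) /\
  (\int[pi]_x (ln (g x))%:E = (- logpartition mu F theta)%:E)%E.
Proof.
move=> Fi F0 g.
have gE x : (ln (g x))%:E =
    (\sum_i (- theta 0 i)%:E * (F x 0 i)%:E + (- logpartition mu F theta)%:E)%E.
  rewrite /g expRK EFinD; congr (_ + _)%E; rewrite /dotp -sumrN -sumEFin.
  by apply: eq_bigr => i _; rewrite -EFinM mulNr.
have si : pi.-integrable setT
    (fun x => \sum_i (- theta 0 i)%:E * (F x 0 i)%:E)%E.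
  by apply: integrable_sum => // i _; exact: integrableZl.
have ci :=
  finite_measure_integrable_cst pi (- logpartition mu F theta) measurableT.
split.
  by under eq_fun do rewrite gE; exact: (integrableD measurableT si ci).
under eq_integral do rewrite gE.
rewrite [LHS](integralD measurableT si ci) integral_sum//; last first.
  by move=> i; exact: integrableZl.
rewrite big1 ?add0e => [|i _].
  rewrite [LHS](integral_cst pi measurableT (- logpartition mu F theta)%:E).
  by rewrite [X in (_ * X)%E]probability_setT mule1.
by rewrite integralZl// [X in (_ * X)%E]F0 mule0.
Qed.

End gibbs_measure.

(** * Integrability of [F] under measures with a finite moment of order alpha *)

Section constraints.
Context {R : realType} {d p : nat} {F : 'rV[R]_d -> 'rV[R]_p} {alpha : R}
  (cF : continuous F)
  (growthF : exists2 C : R, 0 <= C &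
      (ereal_sup (range (fun x : 'rV[R]_d =>
         (enorm (F x) * (1 + enorm x `^ alpha)^-1)%:E)) <= C%:E)%E).

(** Each coordinate is dominated by C (1 + |x|^alpha), which is integrable for a probability in
    [Palpha alpha]. *)
Lemma Palpha_integrable_coord (pi : probability (borelRV R d) R) j :
  Palpha alpha pi -> pi.-integrable setT (fun x => (F x 0 j)%:E).
Proof.
move=> pia; have [C C0 supC] := growthF.
have mt := @measurable_enorm_powR R d alpha.
have ti : pi.-integrable setT (fun x => (enorm x `^ alpha)%:E).
  by apply/ge0_integrableP => // x; exact: powR_ge0.
have ci := finite_measure_integrable_cst pi (1 : R) measurableT.
apply: (le_integrable measurableT _ _
  (integrableZl measurableT C (integrableD measurableT ci ti))).
  by apply/measurable_EFinP; exact: continuous_coord_measurable.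
move=> x _; have t0 : 0 <= enorm x `^ alpha by exact: powR_ge0.
rewrite -[(EFin \o cst 1) x]/(1%:E) -EFinD -EFinM !abse_EFin lee_fin.
rewrite (le_trans (normr_coord_le_enorm _ _))// ger0_norm ?mulr_ge0 ?addr_ge0//.
rewrite -ler_pdivrMr ?ltr_pwDl// -lee_fin (le_trans _ supC)//.
by apply: ereal_sup_ubound; exists x.
Qed.

End constraints.

(** * Smoothness, the gradient formula, and optimality with uniqueness of the Gibbs measure *)

Theorem proposition4 (R : realType) (d p : nat)
    (mu : probability (borelRV R d) R)
    (F : 'rV[R]_d -> 'rV[R]_p) (x0 : 'rV[R]_d) (Fx0 : F x0 = 0)
    (alpha : R) (alpha_ge0 : 0 <= alpha)
    (cF : continuous F)
    (growthF : exists2 C : R, 0 <= C &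
      (ereal_sup (range (fun x : 'rV[R]_d =>
         (enorm (F x) * (1 + enorm x `^ alpha)^-1)%:E)) <= C%:E)%E)
    (expmu : exists2 eta : R, 0 < eta &
      (\int[mu]_x (expR (eta * enorm x `^ alpha))%:E < +oo)%E) :
  [/\ Cinfty (interior (Theta mu F)) (logpartition mu F),
      forall (theta : 'rV[R]_p) (hth : interior (Theta mu F) theta)
        (j : 'I_p),
        (grad (logpartition mu F) theta 0 j)%:E =
        (- mean (gibbs cF (interior_subset hth)) F j)%E
    & forall (theta : 'rV[R]_p) (hth : interior (Theta mu F) theta),
        grad (logpartition mu F) theta = 0 ->
        unique_minimizer mu alpha F (gibbs cF (interior_subset hth))].
Proof.
have mF i : measurable_fun setT (fun x : borelRV R d => F x 0 i).
  exact: continuous_coord_measurable.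
split=> [|theta th j|theta th grad0].
- rewrite logpartitionE; exact: (Cinfty_ln_moment mu F mF).
- exact: grad_logpartition.
have [eta eta0 etaoo] := expmu.
pose g x := expR (- dotp theta (F x) - logpartition mu F theta).
set pith := gibbs cF _.
have hg : has_density mu pith g by exact: gibbs_has_density.
have g0 x : 0 < g x by exact: expR_gt0.
have mt := @measurable_enorm_powR R d alpha.
(* The moment of order alpha is finite by [interior_integrable_mul] with t = |x|^alpha; the zero
   mean is the vanishing gradient. *)
have pithF : PalphaF alpha F pith.
  split=> [|j].
    apply/(ge0_integrableP pith _ mt) => [x|]; first exact: powR_ge0.
    apply: (integrable_gibbs mu F cF theta (interior_subset th)) => //.
    apply: (interior_integrable_mul mu F mF _ eta theta mt _ eta0 etaoo th) => x.
    exact: powR_ge0.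
  have := grad_logpartition mu F cF theta th j.
  by rewrite grad0 mxE => /esym/eqP; rewrite oppe_eq0 => /eqP.
have KLge (pi : probability (borelRV R d) R) : PalphaF alpha F pi ->
    ((- logpartition mu F theta)%:E <= KL pi mu)%E /\
    (KL pi mu = (- logpartition mu F theta)%:E ->
     forall A, measurable A -> pi A = pith A).
  move=> [pia pi0]; have [pimu|npimu] := pselect (pi `<< mu); last first.
    by rewrite /KL asboolF//; split; first exact: leey.
  have [r hr] := dominates_has_density mu pi pimu.
  have [lgi lgE] := integral_ln_gibbs mu F pi theta
    (fun j => Palpha_integrable_coord cF growthF pi j pia) pi0.
  by rewrite -lgE; exact: (KL_lower_bound mu pi pith r g hr hg g0 lgi).
(* For [pith] itself r = g, so the divergence is the integral of ln g against [pith], and the bound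
   is attained. *)
have KLpith : KL pith mu = (- logpartition mu F theta)%:E.
  have [pia pi0] := pithF.
  have [lgi lgE] := integral_ln_gibbs mu F pith theta
    (fun j => Palpha_integrable_coord cF growthF pith j pia) pi0.
  rewrite (KL_has_density mu pith g hg) -lgE.
  rewrite (integral_has_density mu pith g _ hg lgi).
  by apply: eq_integral => x _; rewrite mulrC.
split; first by split=> // pi /KLge[? _]; rewrite KLpith.
move=> pi [piF piM] A mA; have [KL1 KL2] := KLge _ piF.
(* Another minimizer also reaches - L(theta), so the equality case identifies it with [pith]. *)
by apply: KL2 => //; apply/eqP; rewrite eq_le KL1 andbT -KLpith; exact: piM.
Qed.
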